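(* Let $f\in\mathcal{F}_{\mu,L}$ with minimizer $x^*$, let $s>0$, and consider the iteration, for $k\ge 0$, $$x_{k+1}-x_k=-m\sqrt{s}\,\nabla f(x_k)-n\sqrt{s}\,(x_{k+1}-v_k),$$ $$v_{k+1}-v_k=-p\sqrt{s}\,\nabla f(x_{k+1})-q\sqrt{s}\,(v_k-x_{k+1}),$$ initialized with an arbitrary point $x_0\in\mathbb{R}^d$ and $v_0=x_0-\frac{m}{n}\nabla f(x_0)$. If $q/p\le\mu$, $0\le nps\le m\sqrt{s}\le 1/L$, $0\le q\sqrt{s}<1$, $p>0$, and $n=q$, then the Lyapunov function $$\varepsilon(k)=f(x_k)-f(x^* )+\frac{n}{2p}\|v_k-x^*\|^2-\frac{nps}{2}\|\nabla f(x_k)\|^2$$ satisfies $\varepsilon(k)\le(1-q\sqrt{s})^k\varepsilon(0)$ for all $k\ge 0$. Furthermore, $$f(x_k)-f(x^* )\le C''_{GM}(1-q\sqrt{s})^k\quad\text{for all }k\ge 0,$$ where $C''_{GM}$ is a positive constant.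
   Context: $\mathcal{F}_{\mu,L}$ ($0<\mu\le L$) is the class of functions $f:\mathbb{R}^d\to\mathbb{R}$ that are $\mu$-strongly convex and $L$-smooth (the gradient is $L$-Lipschitz). $m,n,p,q$ are non-negative real parameters ($n\neq 0$ being implicit in the definition of $v_0$), and $\|\cdot\|$ is the Euclidean norm. The constant $C''_{GM}$ does not depend on $k$ (it may depend on $f$, the starting point and the parameters). *)

(* Defs.v *)
From HB Require Import structures.
From mathcomp Require Import all_boot all_order all_algebra.
From mathcomp Require Import all_classical all_reals all_analysis.
Import Order.TTheory GRing.Theory Num.Theory.
Import numFieldNormedType.Exports.

Set Implicit Arguments.
Unset Strict Implicit.
Unset Printing Implicit Defensive.

Local Open Scope classical_set_scope.
Local Open Scope ring_scope.

(* The canonical norm `|x| on 'rV[R]_d is the sup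
   norm, so the Euclidean norm is introduced separately; the two induce the same
   topology, hence the same notion of differentiability. *)
Definition enorm (R : realType) (d : nat) (x : 'rV[R]_d) : R :=
  Num.sqrt (\sum_(i < d) x 0 i ^+ 2).

(* Only meaningful where f is differentiable: 'D_v f x is a total operator. *)
Definition gradient (R : realType) (d : nat) (f : 'rV[R]_d -> R)
    (x : 'rV[R]_d) : 'rV[R]_d :=
  \row_(i < d) 'D_(delta_mx 0 i) f x.

Definition strongly_convex (R : realType) (d : nat) (mu : R)
    (f : 'rV[R]_d -> R) : Prop :=
  convex_function [set: 'rV[R]_d] (fun x => f x - mu / 2 * enorm x ^+ 2).

Definition smooth (R : realType) (d : nat) (L : R) (f : 'rV[R]_d -> R) : Prop :=
  (forall x, differentiable f x) /\
  (forall x y, enorm (gradient f x - gradient f y) <= L * enorm (x - y)).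

Definition lyapunov (R : realType) (d : nat) (f : 'rV[R]_d -> R)
    (xstar : 'rV[R]_d) (n p s : R) (x v : nat -> 'rV[R]_d) (k : nat) : R :=
  f (x k) - f xstar + n / (2 * p) * enorm (v k - xstar) ^+ 2
  - n * p * s / 2 * enorm (gradient f (x k)) ^+ 2.

(* Main.v *)
Require Import Defs.
From HB Require Import structures.
From mathcomp Require Import all_boot all_order all_algebra.
From mathcomp Require Import ring lra.
From mathcomp Require Import all_classical all_reals all_analysis.
Import Order.TTheory GRing.Theory Num.Theory.
Import numFieldNormedType.Exports.
Local Open Scope ring_scope.

(** Along the iteration the energy
      E(k) = f(x_k) - f(xstar) + n/(2p) |v_k - xstar|^2 - nps/2 |g_k|^2,
    with g_k the gradient of f at x_k, contracts by 1 - a at every step, where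
    a = n sqrt(s) = q sqrt(s).  Put w = v_k - xstar, y = x_{k+1} - xstar,
    G = g_{k+1}, g = g_k and b = m sqrt(s).  Since
    v_{k+1} - xstar = (1 - a) w + a y - p sqrt(s) G, expanding n/(2p)
    times its square produces the term nps/2 |G|^2, which the last summand of E(k+1) cancels
    exactly, and the cross term -a <G, (1 - a) w + a y>, which equals
    -a <G, y> - (1 - a) <G, a (w - y)>.

    The first part of the cross term is absorbed by strong convexity between
    x_{k+1} and xstar; the resulting -a mu/2 |y|^2 pays for the a n/(2p) |y|^2
    left by the convexity of the square, because n/p = q/p <= mu.  For the
    second part, the x-update says a (w - y) = x_{k+1} - x_k + b g, and the
    smooth convex lower bound [smooth_convex_lower_bound] leaves
      f(x_k) - 1/(2L) |G - g|^2 - b <G, g> <= f(x_k) - b/2 (|g|^2 + |G|^2)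
    as b <= 1/L.  Here b >= nps covers the gradient term of E(k), and
    (1 - a) b/2 |G|^2 is still left over ([lyapunov_contraction]).

    That surplus gives the rate on f.  In the extreme case nps = b = 1/L the
    energy does not control f(x_k) - f(xstar), since the negative gradient term
    may use up the whole gap; it is however always nonnegative
    ([lyapunov_ge0]).  So the surplus yields b/2 |g_{k+1}|^2 <= E(k), whence
    f(x_{k+1}) - f(xstar) <= E(k+1) + E(k), and both terms decay like (1 - a)^k. *)

(** * The Euclidean inner product *)

Definition dotv {R : realType} {d : nat} (u w : 'rV[R]_d) : R :=
  \sum_(i < d) u 0 i * w 0 i.

Lemma dotvC {R : realType} {d} (u w : 'rV[R]_d) : dotv u w = dotv w u.
Proof. by apply: eq_bigr => i _; rewrite mulrC. Qed.

Lemma dotvDl {R : realType} {d} (u1 u2 w : 'rV[R]_d) :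
  dotv (u1 + u2) w = dotv u1 w + dotv u2 w.
Proof. by rewrite -big_split; apply: eq_bigr => i _; rewrite mxE mulrDl. Qed.

Lemma dotvZl {R : realType} {d} (a : R) (u w : 'rV[R]_d) :
  dotv (a *: u) w = a * dotv u w.
Proof. by rewrite mulr_sumr; apply: eq_bigr => i _; rewrite mxE mulrA. Qed.

Lemma dotvNl {R : realType} {d} (u w : 'rV[R]_d) : dotv (- u) w = - dotv u w.
Proof. by rewrite -scaleN1r dotvZl mulN1r. Qed.

Lemma dotvDr {R : realType} {d} (u w1 w2 : 'rV[R]_d) :
  dotv u (w1 + w2) = dotv u w1 + dotv u w2.
Proof. by rewrite dotvC dotvDl !(dotvC u). Qed.

Lemma dotvZr {R : realType} {d} (a : R) (u w : 'rV[R]_d) :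
  dotv u (a *: w) = a * dotv u w.
Proof. by rewrite dotvC dotvZl (dotvC u). Qed.

Lemma dotvNr {R : realType} {d} (u w : 'rV[R]_d) : dotv u (- w) = - dotv u w.
Proof. by rewrite dotvC dotvNl (dotvC u). Qed.

Definition dotvE :=
  (@dotvDl, @dotvDr, @dotvNl, @dotvNr, @dotvZl, @dotvZr).

Lemma dotv_ge0 {R : realType} {d} (u : 'rV[R]_d) : 0 <= dotv u u.
Proof. by apply: sumr_ge0 => i _; rewrite -expr2 sqr_ge0. Qed.

(** With a = L c and u the variation of the gradient over a displacement c w,
    this turns the Lipschitz bound |u| <= L c |w| into <u, w> <= L c |w|^2,
    which is how Cauchy-Schwarz would be used in [descent]. *)
Lemma dotv_young {R : realType} {d} (a : R) (u w : 'rV[R]_d) :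
  2 * a * dotv u w <= dotv u u + a ^+ 2 * dotv w w.
Proof. by have := dotv_ge0 (u - a *: w); rewrite !dotvE (dotvC w u); lra. Qed.

Lemma enorm_sqr {R : realType} {d} (u : 'rV[R]_d) : enorm u ^+ 2 = dotv u u.
Proof.
rewrite /enorm sqr_sqrtr; first by apply: eq_bigr => i _; rewrite expr2.
by apply: sumr_ge0 => i _; rewrite sqr_ge0.
Qed.

(** * Consequences of smoothness and strong convexity *)

Lemma derive_gradient {R : realType} {d} (f : 'rV[R]_d -> R) (x u : 'rV[R]_d) :
  differentiable f x -> 'D_u f x = dotv (gradient f x) u.
Proof.
move=> df; rewrite deriveE// {1}(row_sum_delta u) linear_sum.
by apply: eq_bigr => i _; rewrite linearZ /= mxE deriveE// mulrC.
Qed.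

Lemma is_derive_line {R : realType} {d} (f : 'rV[R]_d -> R)
    (x u : 'rV[R]_d) (t : R) :
  differentiable f (x + t *: u) ->
  is_derive t 1 (fun t => f (x + t *: u)) (dotv (gradient f (x + t *: u)) u).
Proof.
move=> df; rewrite -derive_gradient//.
have dfu : derivable f (x + t *: u) u by exact: diff_derivable.
have lineE : (fun h : R => h^-1 *: (((fun t => f (x + t *: u)) \o shift t) (h *: 1)
     - f (x + t *: u))) =
   (fun h : R => h^-1 *: ((f \o shift (x + t *: u)) (h *: u) - f (x + t *: u))).
  apply/funext => h /=; congr (_ *: (f _ - _)).
  by rewrite /shift/= [h *: 1]mulr1 scalerDl addrCA addrA.
by split; rewrite /derivable /derive lineE.
Qed.

(** The quadratic upper model of an L-smooth function: along the segment from x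
    to x + u, the slope of f exceeds its initial value by at most L c |u|^2 at
    time c, so that subtracting the model leaves a function with nonpositive
    derivative. *)
Lemma descent {R : realType} {d} (L : R) (f : 'rV[R]_d -> R) (x u : 'rV[R]_d) :
  0 < L -> smooth L f ->
  f (x + u) <= f x + dotv (gradient f x) u + L / 2 * dotv u u.
Proof.
move=> L0 [df lipf].
pose A := dotv (gradient f x) u.
pose B := L / 2 * dotv u u.
pose phi (t : R) := f (x + t *: u) - (t * A + t ^+ 2 * B).
pose dphi (t : R) := dotv (gradient f (x + t *: u)) u - (A + 2 * t * B).
have dphiE (t : R) : is_derive t (1 : R) phi (dphi t).
  have ? := is_derive_line f x u t (df _).
  rewrite /phi; apply: is_derive_eq.
  by rewrite /dphi /GRing.scale/=; ring.
have phi_cont : {within `[0, 1], continuous phi}%classic.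
  by apply: derivable_within_continuous => t _; exact: ex_derive.
have [c] := @MVT R phi dphi 0 1 ltr01 (fun t _ => dphiE t) phi_cont.
rewrite in_itv/= => /andP[c0 c1].
rewrite /phi subr0 mulr1 scale1r scale0r addr0 => E.
suff : dphi c <= 0 by move: E; rewrite /A /B; lra.
set D := gradient f (x + c *: u) - gradient f x.
have lipD : dotv D D <= (L * c) ^+ 2 * dotv u u.
  have -> : (L * c) ^+ 2 * dotv u u = (L * enorm (x + c *: u - x)) ^+ 2.
    by rewrite [RHS]exprMn enorm_sqr [x + _]addrC addrK !dotvE; ring.
  by rewrite -enorm_sqr ler_pXn2r ?nnegrE ?sqrtr_ge0 ?mulr_ge0 ?sqrtr_ge0 ?(ltW L0)//;
    exact: lipf.
have := dotv_young (L * c) D u => young.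
have : (L * c) * dotv D u <= (L * c) * (L * c * dotv u u) by lra.
rewrite ler_pM2l ?mulr_gt0// /dphi /A /B /D !dotvE; lra.
Qed.

(** Convexity of f - mu/2 |.|^2 on the segment from x to x + u bounds the
    difference quotient of f by f (x + u) - f x - mu/2 (1 - t) |u|^2; the
    gradient appears as t tends to 0 from the right. *)
Lemma strongly_convex_gradient {R : realType} {d} (mu : R)
    (f : 'rV[R]_d -> R) (x u : 'rV[R]_d) :
  strongly_convex mu f -> differentiable f x ->
  f x + dotv (gradient f x) u + mu / 2 * dotv u u <= f (x + u).
Proof.
move=> cf df.
have dfu : derivable f x u by exact: diff_derivable.
rewrite -derive_gradient//.
suff : 'D_u f x <= f (x + u) - f x - mu / 2 * dotv u u by lra.
(* The slack mu/2 t |u|^2 vanishes in the limit; subtracting it beforehand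
   leaves a bound independent of t. *)
pose q (t : R) := t^-1 *: ((f \o shift x) (t *: u) - f x) - t * (mu / 2 * dotv u u).
have q_cvg : (q t @[t --> 0^'+] --> 'D_u f x)%classic.
  rewrite -[X in (_ --> X)%classic]subr0 -{2}(mul0r (mu / 2 * dotv u u)).
  apply: cvgB; first exact: cvg_dnbhs_at_right.
  by apply: cvgMl; exact: cvg_within_filter.
rewrite -(cvg_lim _ q_cvg)//; apply: limr_le.
  by apply/cvg_ex; exists ('D_u f x).
near=> t.
have t0 : 0 < t by near: t; exact: nbhs_right_gt.
have t1 : t <= 1 by near: t; exact: nbhs_right_le.
have := cf (Itv01 (ltW t0) t1) (u + x) x (mem_setT _) (mem_setT _).
rewrite convRE /conv/= !enorm_sqr.
have <- : t *: u + x = t *: (u + x) + unstable.onem t *: x.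
  by rewrite scalerBl scale1r scalerDr -addrA subrKC.
rewrite [x + u]addrC => conv_le.
rewrite /q /shift/= -[t^-1 *: _]/(t^-1 * _) [t^-1 * _]mulrC lerBlDr.
rewrite ler_pdivrMr//.
by move: conv_le; rewrite /unstable.onem !dotvE (dotvC x u); lra.
Unshelve. all: by end_near.
Qed.

(** The affine minorant of f at x and the quadratic majorant of f at y are
    compared at the point y - (gradient f y - gradient f x) / L, where their
    difference is smallest. *)
Lemma smooth_convex_lower_bound {R : realType} {d} (mu L : R) (f : 'rV[R]_d -> R)
    (x y : 'rV[R]_d) :
  0 <= mu -> 0 < L -> strongly_convex mu f -> smooth L f ->
  f x + dotv (gradient f x) (y - x)
    + (2 * L)^-1 * dotv (gradient f y - gradient f x) (gradient f y - gradient f x)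
  <= f y.
Proof.
move=> mu0 L0 cf sf; set D := gradient f y - gradient f x.
have := descent L f y (- (L^-1 *: D)) L0 sf.
have := strongly_convex_gradient mu f x (y - L^-1 *: D - x) cf (sf.1 x).
rewrite subrKC.
have : 0 <= mu / 2 * dotv (y - L^-1 *: D - x) (y - L^-1 *: D - x).
  by rewrite mulr_ge0 ?dotv_ge0// divr_ge0.
rewrite addrAC; set u := y - x.
have -> : gradient f y = D + gradient f x by rewrite subrK.
rewrite (dotvDr (gradient f x) u) !(dotvDl D) !dotvNl !dotvNr !dotvZl !dotvZr.
have LE : L / 2 * (L^-1 * (L^-1 * dotv D D)) = (2 * L)^-1 * dotv D D.
  by field; rewrite gt_eqF.
have LE2 : L^-1 * dotv D D = 2 * ((2 * L)^-1 * dotv D D).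
  by field; rewrite gt_eqF.
rewrite opprK LE LE2; lra.
Qed.

(** A gradient step of length 1 / L decreases f by at least |gradient|^2 / (2L),
    and cannot go below the lower bound c. *)
Lemma gradient_sqr_le_gap {R : realType} {d} (L c : R) (f : 'rV[R]_d -> R)
    (x : 'rV[R]_d) :
  0 < L -> smooth L f -> (forall y, c <= f y) ->
  (2 * L)^-1 * dotv (gradient f x) (gradient f x) <= f x - c.
Proof.
move=> L0 sf cf; have := descent L f x (- (L^-1 *: gradient f x)) L0 sf.
have := cf (x - L^-1 *: gradient f x).
rewrite !dotvNr dotvNl !dotvZr dotvZl; set G := dotv _ _.
have -> : L / 2 * - - (L^-1 * (L^-1 * G)) = (2 * L)^-1 * G.
  by field; rewrite gt_eqF.
have -> : L^-1 * G = 2 * ((2 * L)^-1 * G) by field; rewrite gt_eqF.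
lra.
Qed.

(** * The energy along the iteration *)

(** The surplus on the left-hand side, a multiple of |gradient f (x k.+1)|^2, is
    what turns decay of the energy into decay of f, which the energy alone does
    not bound. *)
Lemma lyapunov_contraction {R : realType} {d} {mu L : R} {f : 'rV[R]_d -> R}
    {xstar : 'rV[R]_d} {m n p s : R} {x v : nat -> 'rV[R]_d} {k : nat} :
  0 < mu -> 0 < L -> strongly_convex mu f -> smooth L f ->
  0 <= n -> 0 < p -> 0 <= s ->
  x k.+1 - x k =
     - (m * Num.sqrt s) *: gradient f (x k)
     - (n * Num.sqrt s) *: (x k.+1 - v k) ->
  v k.+1 - v k =
     - (p * Num.sqrt s) *: gradient f (x k.+1)
     - (n * Num.sqrt s) *: (v k - x k.+1) ->
  n / p <= mu -> n * p * s <= m * Num.sqrt s -> m * Num.sqrt s <= L^-1 ->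
  n * Num.sqrt s <= 1 ->
  lyapunov f xstar n p s x v k.+1
    + (1 - n * Num.sqrt s) * (m * Num.sqrt s / 2
         * dotv (gradient f (x k.+1)) (gradient f (x k.+1)))
  <= (1 - n * Num.sqrt s) * lyapunov f xstar n p s x v k.
Proof.
move=> mu0 L0 cf sf n0 p0 s0 hx hv npmu nps mL a1.
rewrite /lyapunov !enorm_sqr.
have sE : s = Num.sqrt s ^+ 2 by rewrite sqr_sqrtr.
move: (Num.sqrt s) (sqrtr_ge0 s) sE hx hv nps mL a1 => r r0 sE hx hv nps mL a1.
have a1' : 0 <= 1 - n * r by rewrite subr_ge0.
set a := n * r in a1' *; set b := m * r in nps mL *; set c := n / (2 * p).
have a0 : 0 <= a by rewrite mulr_ge0.
have c0 : 0 <= c by rewrite divr_ge0 ?mulr_ge0 ?(ltW p0).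
have cpr : c * (2 * (p * r)) = a by rewrite /c /a; field; rewrite gt_eqF.
have cprr : c * (p * r) ^+ 2 = n * p * s / 2.
  by rewrite /c sE; field; rewrite gt_eqF.
have cmu : c <= mu / 2.
  have -> : c = n / p / 2 by rewrite /c; field; rewrite gt_eqF.
  by rewrite ler_pM2r ?invr_gt0.
set g := gradient f (x k); set G := gradient f (x k.+1).
set w := v k - xstar; pose y := x k.+1 - xstar.
have xE : x k - x k.+1 = b *: g - a *: (w - y).
  apply/rowP => i; have := congr1 (fun z : 'rV_d => z 0 i) hx.
  by rewrite !mxE -/g /a /b /w /y; lra.
have vE : v k.+1 - xstar = (1 - a) *: w + a *: y - (p * r) *: G.
  apply/rowP => i; have := congr1 (fun z : 'rV_d => z 0 i) hv.
  by rewrite !mxE -/G /a /w /y; lra.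
(* The two analytic inputs: comparison of f at x_{k+1} with f at x_k, and with f
   at xstar. *)
have coco := smooth_convex_lower_bound mu L f (x k.+1) (x k) (ltW mu0) L0 cf sf.
have sc := strongly_convex_gradient mu f (x k.+1) (- y) cf (sf.1 _).
move: coco sc.
have -> : x k.+1 - y = xstar by rewrite /y subKr.
rewrite -/g -/G xE vE; clearbody g G w y.
rewrite !dotvE (dotvC g G) (dotvC y w) (dotvC w G) (dotvC y G).
have := dotv_ge0 (w - y); rewrite !dotvE (dotvC y w) => wy0.
have := dotv_ge0 (g - G); rewrite !dotvE (dotvC g G) => gG0.
have yy0 := dotv_ge0 y; have gg0 := dotv_ge0 g.
move=> coco sc.
(* What remains is the combination with weights 1 - a and a of these two
   inequalities, with |g - G|^2 weighted through b <= 1/L and |w - y|^2 through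
   the convexity of the square. *)
have coco' := ler_wpM2l a1' coco.
have sc' := ler_wpM2l a0 sc.
have young := ler_wpM2l a1' (ler_wpM2r gG0 mL).
have step := ler_wpM2l a1' (ler_wpM2r gg0 nps).
have strong := ler_wpM2l a0 (ler_wpM2r yy0 cmu).
have jensen := mulr_ge0 (mulr_ge0 c0 (mulr_ge0 a0 a1')) wy0.
have Gw := congr1 ( *%R^~ (dotv G w)) cpr.
have aGw := congr1 ( *%R^~ (a * dotv G w)) cpr.
have aGy := congr1 ( *%R^~ (a * dotv G y)) cpr.
have GG := congr1 ( *%R^~ (dotv G G)) cprr.
move: coco' young; rewrite invfM.
move: L^-1 => l coco' young.
clearbody a b c.
lra.
Qed.

(** The negative term is at most |gradient|^2 / (2L), which the optimality gap
    dominates. *)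
Lemma lyapunov_ge0 {R : realType} {d} {L : R} {f : 'rV[R]_d -> R}
    {xstar : 'rV[R]_d} {n p s : R} (x v : nat -> 'rV[R]_d) (k : nat) :
  0 < L -> smooth L f -> (forall y, f xstar <= f y) ->
  0 <= n -> 0 < p -> n * p * s <= L^-1 ->
  0 <= lyapunov f xstar n p s x v k.
Proof.
move=> L0 sf fmin n0 p0 nps; rewrite /lyapunov !enorm_sqr.
have gap := gradient_sqr_le_gap L _ f (x k) L0 sf fmin.
have : 0 <= n / (2 * p) * dotv (v k - xstar) (v k - xstar).
  by rewrite mulr_ge0 ?dotv_ge0// divr_ge0// mulr_ge0// ltW.
have := ler_wpM2r (dotv_ge0 (gradient f (x k))) nps.
by move: gap; rewrite invfM; lra.
Qed.

(** * Linear convergence *)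

Theorem theorem5 (R : realType) (d : nat) (mu L : R) (f : 'rV[R]_d -> R)
  (xstar : 'rV[R]_d) (m n p q s : R) (x v : nat -> 'rV[R]_d)
  (hmu : 0 < mu) (hmuL : mu <= L)
  (hconvex : strongly_convex mu f) (hsmooth : smooth L f)
  (hmin : forall y, f xstar <= f y)
  (hm : 0 <= m) (hn : 0 <= n) (hn0 : n != 0) (hp : 0 < p) (hq : 0 <= q)
  (hs : 0 < s)
  (hx : forall k, x k.+1 - x k =
     - (m * Num.sqrt s) *: gradient f (x k)
     - (n * Num.sqrt s) *: (x k.+1 - v k))
  (hv : forall k, v k.+1 - v k =
     - (p * Num.sqrt s) *: gradient f (x k.+1)
     - (q * Num.sqrt s) *: (v k - x k.+1))
  (hv0 : v 0%N = x 0%N - (m / n) *: gradient f (x 0%N))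
  (hqp : q / p <= mu)
  (hnps0 : 0 <= n * p * s) (hnps : n * p * s <= m * Num.sqrt s)
  (hmL : m * Num.sqrt s <= L^-1)
  (hqs0 : 0 <= q * Num.sqrt s) (hqs1 : q * Num.sqrt s < 1)
  (hnq : n = q) :
  (forall k, lyapunov f xstar n p s x v k
     <= (1 - q * Num.sqrt s) ^+ k * lyapunov f xstar n p s x v 0) /\
  (exists C : R, 0 < C /\
     forall k, f (x k) - f xstar <= C * (1 - q * Num.sqrt s) ^+ k).
Proof.
subst q; set a := n * Num.sqrt s in hqs0 hqs1 *.
set E := lyapunov f xstar n p s x v.
have L0 : 0 < L by exact: lt_le_trans hmu hmuL.
have a0 : 0 < 1 - a by rewrite subr_gt0.
have E0 k : 0 <= E k.
  by apply: (lyapunov_ge0 (L := L)) => //; exact: le_trans hnps hmL.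
pose gsq k := dotv (gradient f (x k)) (gradient f (x k)).
have step k : E k.+1 + (1 - a) * (m * Num.sqrt s / 2 * gsq k.+1)
    <= (1 - a) * E k.
  exact: (lyapunov_contraction hmu L0 hconvex hsmooth hn hp (ltW hs)
    (hx k) (hv k) hqp hnps hmL (ltW hqs1)).
have mg0 k : 0 <= m * Num.sqrt s / 2 * gsq k.
  by rewrite mulr_ge0 ?dotv_ge0// divr_ge0// mulr_ge0 ?sqrtr_ge0.
have decay k : E k <= (1 - a) ^+ k * E 0%N.
  elim: k => [|k IH]; first by rewrite expr0 mul1r.
  rewrite exprS -mulrA; apply: (le_trans _ (ler_wpM2l (ltW a0) IH)).
  by apply: (le_trans _ (step k)); rewrite lerDl mulr_ge0// ltW.
split=> //.
pose F0 := f (x 0%N) - f xstar.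
have F00 : 0 <= F0 by rewrite subr_ge0.
(* F0 accounts for k = 0, where no earlier energy bounds the gradient; the
   inverse of 1 - a shifts the exponent of E k to k.+1, and 1 ensures
   positivity. *)
exists (F0 + E 0%N * (1 + (1 - a)^-1) + 1); split.
  by rewrite ltr_wpDl// addr_ge0// mulr_ge0// addr_ge0// invr_ge0 ltW.
have C1 : 0 <= E 0%N * (1 + (1 - a)^-1).
  by rewrite mulr_ge0// addr_ge0// invr_ge0 ltW.
case=> [|k]; first by rewrite expr0 mulr1 -/F0; lra.
(* The surplus of the contraction step, once E k.+1 >= 0 is dropped. *)
have grad : m * Num.sqrt s / 2 * gsq k.+1 <= E k.
  rewrite -(ler_pM2l a0); apply: (le_trans _ (step k)).
  by rewrite lerDr.
have gap : f (x k.+1) - f xstar <= E k.+1 + E k.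
  rewrite /E /lyapunov !enorm_sqr -/(gsq k.+1).
  have vv0 : 0 <= n / (2 * p) * dotv (v k.+1 - xstar) (v k.+1 - xstar).
    by rewrite mulr_ge0 ?dotv_ge0// divr_ge0// mulr_ge0// ltW.
  have := ler_wpM2r (dotv_ge0 (gradient f (x k.+1))) hnps.
  move: grad; rewrite {1}/E /lyapunov !enorm_sqr -/(gsq k.+1); lra.
have pw : (1 - a) ^+ k = (1 - a)^-1 * (1 - a) ^+ k.+1.
  by rewrite exprS mulKf// gt_eqF.
apply: le_trans gap _.
have : 0 <= (F0 + 1) * (1 - a) ^+ k.+1.
  by apply: mulr_ge0; [exact: addr_ge0 | exact/exprn_ge0/ltW].
have := decay k; rewrite {1}pw; have := decay k.+1.
move: ((1 - a) ^+ k.+1) ((1 - a)^-1) (E k.+1) (E k) (E 0%N).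
by clearbody F0 => pow inv Ek1 Ek E0'; lra.
Qed.
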